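(* Consider the infinite server G/G/$\infty$ queue with fixed inter-generation time $X\sim F_X$, $\mathbb{E}[X]=1/\lambda$, $\lambda<\mu$. Let the service time $S$ be continuous with distribution $F_S$ depending on a parameter $\eta$, and suppose that for some $\eta^*$ and for all $x>0$: 1. $\mathbb{E}[S]=1/\mu$ (for all $\eta$); 2. $\mathbb{E}[\mathbb{I}_{\{S>x\}}]\to0$ as $\eta\to\eta^*$; and 3. $\mathbb{E}[S\,\mathbb{I}_{\{S\le x\}}]\to0$ as $\eta\to\eta^*$. Then $$\lim_{\eta\to\eta^*}A^{\mathrm{ave}}_{\mathrm{G/G/}\infty}(F_S)=\frac12\frac{\mathbb{E}[X^2]}{\mathbb{E}[X]}.$$
   Context: Update packets $i=1,2,\dots$ are generated at times $t_1<t_2<\cdots$ of a renewal process with i.i.d. inter-generation times distributed as $X$. In the G/G/$\infty$ queue each generated packet is immediately put into service at its own new server; service times $S_i$ are i.i.d. with distribution $F_S$, independent of the generation process, so packet $i$ reaches the destination at time $t_i'=t_i+S_i$. With $\mathcal{P}(t)$ the set of packets received up to time $t$, the age is $A(t)=\min_{i\in\mathcal{P}(t)}(t-t_i)$ and the average age is $A^{\mathrm{ave}}=\limsup_{T\to\infty}\mathbb{E}\left[\frac1T\int_0^TA(t)\,dt\right]$, denoted $A^{\mathrm{ave}}_{\mathrm{G/G/}\infty}(F_S)$ for this queue. $\mathbb{I}$ denotes an indicator; the dependence of $S$ and $F_S$ on $\eta$ is suppressed in the notation. *)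

(* Defs.v *)
From HB Require Import structures.
From mathcomp Require Import all_boot all_order all_algebra finmap.
From mathcomp Require Import all_classical all_reals all_analysis.

Set Implicit Arguments.
Unset Strict Implicit.
Unset Printing Implicit Defensive.

Import Order.TTheory GRing.Theory Num.Theory.
Import numFieldNormedType.Exports.

Local Open Scope classical_set_scope.
Local Open Scope ring_scope.

Section Independence.
Context {R : realType} d {T : measurableType d} (P : probability T R).
Implicit Types Y Z : nat -> {RV P >-> R}.
Local Open Scope ereal_scope.

Definition mutually_independent Y : Prop :=
  forall (J : {fset nat}) (B : nat -> set R), (forall i, measurable (B i)) ->
    P (\bigcap_(i in [set` J]) (Y i @^-1` B i))
    = \prod_(i <- J) P (Y i @^-1` B i).

Definition has_law Y (F : probability R R) : Prop :=
  forall i (B : set R), measurable B -> distribution P (Y i) B = F B.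

Definition iid Y (F : probability R R) : Prop :=
  mutually_independent Y /\ has_law Y F.

(* The sigma-algebra on the sample space generated by the whole sequence. *)
Definition process_sigma Y : set (set T) :=
  <<s \bigcup_i preimage_set_system setT (Y i) measurable >>.

Definition independent_processes Y Z : Prop :=
  forall A B, process_sigma Y A -> process_sigma Z B ->
    P (A `&` B) = P A * P B.

End Independence.

Section Age.
Context {R : realType} d {T : measurableType d} (P : probability T R).

(* Packets are indexed from 0, so that index i stands for packet i + 1. X i is
   the time between the generation of packets i and i + 1 (the renewal process
   starts at time 0) and S i is the service time of packet i + 1. *)
Variables (X S : nat -> {RV P >-> R}).

(* Every packet has its own server, so there is no waiting time. *)
Record GGinf_queue (FX FS : probability R R) : Prop := {
  inter_generation_gt0 : forall i w, 0 < X i w;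
  service_ge0 : forall i w, 0 <= S i w;
  inter_generation_iid : iid X FX;
  service_iid : iid S FS;
  generation_service_independent : independent_processes X S }.

Definition gen_time (i : nat) (w : T) : R := \sum_(k < i.+1) X k w.

Definition recv_time (i : nat) (w : T) : R := gen_time i w + S i w.

Definition received (t : R) (w : T) : set nat := [set i | recv_time i w <= t].

(* The destination initially holds an update of age a0. Since gen_time is
   positive, the value a0 + t is the infimum only as long as no packet has been
   received; afterwards the age is the least t - gen_time i over the received
   packets. The infimum is attained whenever finitely many packets are generated
   up to time t, hence almost surely. *)
Definition age (a0 : R) (t : R) (w : T) : R :=
  inf ([set a0 + t] `|` [set t - gen_time i w | i in received t w]).

(* The time integral is real-valued because the age lies in [0, a0 + t] when
   0 <= a0; only the limsup may be infinite. *)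
Definition average_age (a0 : R) : \bar R :=
  limf_esup
    (fun tau : R => 'E_P[fun w =>
       (tau^-1 * \int[lebesgue_measure]_(t in `[0, tau]) age a0 t w)%R]%E)
    (pinfty_nbhs R).

End Age.

(* Main.v *)
(* Only the times s_i = X_0 + ... + X_(i-1) matter. If m(t) is the expected
   number of i with s_i <= t, then Wald's identity
   E[sum_i 1{s_i <= t} f(X_i)] = m(t) E[f(X)] applied to f = min(., c) and to
   f = id gives m(t) E[min(X, c)] <= t + c and t <= m(t) E[X], so m(t)/t tends to
   1/E[X].
   Lower bound: on [s_i, s_(i+1)[ the age is at least the time elapsed since s_i,
   so the integral of the age up to t is at least the sum of the X_i^2/2 over the
   completed periods; X^2 is truncated in order to control the last one.
   Upper bound: fix delta > 0 and ignore the packets with service time above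
   delta. On [s_i + delta, s_(i+1) + delta] the age is at most V_i + (t - s_i),
   where V_i is the age at time s_i of the last packet that is not ignored. By
   independence E[1{s_i <= t} V_i X_i] is at most a geometric convolution with
   ratio p = P(S > delta), hence the average age is at most
   E[X^2]/(2 E[X]) + delta + delta/E[X] + E[X] p/(1 - p); let first p, then delta
   tend to 0. *)
Require Import Defs.
From HB Require Import structures.
From mathcomp Require Import all_boot all_order all_algebra finmap.
From mathcomp Require Import all_classical all_reals all_analysis.
From mathcomp Require Import measurable_realfun ring lra.

Set Implicit Arguments.
Unset Strict Implicit.
Unset Printing Implicit Defensive.

Import Order.TTheory GRing.Theory Num.Theory.
Import numFieldNormedType.Exports.
Import HBNNSimple HBSimple.

Local Open Scope classical_set_scope.
Local Open Scope ring_scope.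

(** * Monotonicity and truncation of integrals *)

Section Integration.
Context {R : realType} d {T : measurableType d}.
Local Open Scope ereal_scope.

(* The integral of a nonnegative function is a supremum over the simple
   functions below it, so monotonicity needs no measurability. This is why the
   measurability of the age is never needed. *)
Lemma ge0_integral_mono (mu : {measure set T -> \bar R}) (D : set T)
    (f g : T -> \bar R) :
  (forall x, D x -> 0 <= f x) -> (forall x, D x -> f x <= g x) ->
  \int[mu]_(x in D) f x <= \int[mu]_(x in D) g x.
Proof.
move=> f0 fg; rewrite !ge0_integralE//; last first.
  by move=> x Dx; apply: le_trans (fg x Dx); exact: f0.
apply: ereal_sup_le => _ [h /= hf <-].
exists h => //= x.
apply: le_trans (hf x) _; rewrite /patch; case: ifPn => // /set_mem Dx.
exact: fg.
Qed.

(** A simple function below [f] whose integral exceeds [y] is bounded, so it also lies below a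
    truncation of [f]. This covers infinite integrals too. *)
Lemma integral_truncation_gt (mu : {measure set T -> \bar R}) (f : T -> R)
    (y : \bar R) :
  measurable_fun setT f -> (forall x, (0 <= f x)%R) ->
  y < \int[mu]_x (f x)%:E ->
  exists2 c : R, (0 < c)%R & y < \int[mu]_x (Num.min (f x) c)%:E.
Proof.
move=> mf f0; rewrite ge0_integralTE; last by move=> x; rewrite lee_fin.
move=> /ereal_sup_gt[_ [h /= hf <-] yh].
have [M [_ hM]] := simple_bounded h.
have {}hM x : (h x <= `|M| + 1)%R.
  apply: le_trans (ler_norm _) _; apply: hM => //.
  by rewrite (le_lt_trans (ler_norm _))// ltrDl.
exists (`|M| + 1)%R; first by rewrite ltr_wpDl.
apply: lt_le_trans yh _.
rewrite ge0_integralTE; last by move=> x; rewrite lee_fin le_min f0/= addr_ge0.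
apply: ereal_sup_ubound; exists h => //= x.
by rewrite lee_fin le_min hM andbT -lee_fin hf.
Qed.

End Integration.

(** * Expectation of a product of independent variables *)

Section Independent_product.
Context {R : realType} d {T : measurableType d} (P : probability T R).
Local Open Scope ereal_scope.

(** By independence the joint law agrees with the product of the two laws on rectangles, hence
    everywhere; Tonelli's theorem then factors the integral. *)
Lemma expectation_mul_indep (f g : T -> R) :
  measurable_fun setT f -> measurable_fun setT g ->
  (forall w, (0 <= f w)%R) -> (forall w, (0 <= g w)%R) ->
  (forall A B, measurable A -> measurable B ->
    P (f @^-1` A `&` g @^-1` B) = P (f @^-1` A) * P (g @^-1` B)) ->
  \int[P]_w (f w * g w)%:E = \int[P]_w (f w)%:E * \int[P]_w (g w)%:E.
Proof.
move=> mf mg f0 g0 fg.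
pose f' : {mfun T >-> R} := HB.pack f (isMeasurableFun.Build _ _ _ _ _ mf).
pose g' : {mfun T >-> R} := HB.pack g (isMeasurableFun.Build _ _ _ _ _ mg).
have mfg : measurable_fun setT (fun w => (f w, g w)).
  exact/measurable_fun_pair.
pose h' : {mfun T >-> (R * R)%type} :=
  HB.pack (fun w => (f w, g w)) (isMeasurableFun.Build _ _ _ _ _ mfg).
have mF : measurable_fun (setT : set (R * R)%type)
  (EFin \o (fun z => `|z.1| * `|z.2| : R)%R).
  apply/measurable_EFinP; apply: measurable_funM; apply: measurableT_comp => //.
(* The absolute values make the integrand nonnegative on the whole plane and change nothing on the
   values of [f] and [g]. *)
transitivity (\int[distribution P h']_z (`|z.1| * `|z.2|)%:E).
  rewrite ge0_integral_distribution//; apply: eq_integral => w _ /=.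
  by rewrite /= !ger0_norm.
rewrite (eq_measure_integral (distribution P f' \x distribution P g'));
  last first.
  move=> A mA _; symmetry.
  by apply: product_measure_unique.
rewrite fubini_tonelli1//.
rewrite /fubini_F/=.
transitivity (\int[distribution P f']_x (`|x|%:E * \int[P]_w (g w)%:E)).
  apply: eq_integral => x _.
  under eq_integral do rewrite EFinM.
  rewrite ge0_integralZl//; last first.
    by apply/measurable_EFinP; exact: normr_measurable.
  congr (_ * _); rewrite ge0_integral_distribution//.
    by apply: eq_integral => w _ /=; rewrite ger0_norm.
  by apply/measurable_EFinP; exact: normr_measurable.
rewrite ge0_integralZr//; last 2 first.
- by apply/measurable_EFinP; exact: normr_measurable.
- by apply: integral_ge0 => w _; rewrite lee_fin.
congr (_ * _); rewrite ge0_integral_distribution//.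
  by apply: eq_integral => w _ /=; rewrite ger0_norm.
by apply/measurable_EFinP; exact: normr_measurable.
Qed.

End Independent_product.

(** * Integral of an affine function *)

Lemma integral_affine {R : realType} (a b c : R) : a <= b ->
  (\int[lebesgue_measure]_(t in `[a, b]) (t - c)%:E
   = (((b - c) ^+ 2 - (a - c) ^+ 2) / 2)%:E)%E.
Proof.
rewrite le_eqVlt => /predU1P[->|ab].
  by rewrite set_itv1 integral_set1 subrr mul0r.
rewrite (@continuous_FTC2 _ _ (fun t => (t - c) ^+ 2 / 2))//.
- by rewrite -EFinB; congr EFin; rewrite mulrBl.
- apply: continuous_subspaceT => x; apply: cvgB; [exact: cvg_id|exact: cvg_cst].
- have dF : forall x : R, derivable (fun t : R => (t - c) ^+ 2 / 2) x 1.
    move=> x; exact: ex_derive.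
  have cF : continuous (fun t : R => (t - c) ^+ 2 / 2).
    move=> x; apply: differentiable_continuous; exact/derivable1_diffP.
  split.
  + by move=> x _; exact: dF.
  + exact/cvg_at_right_filter/cF.
  + exact/cvg_at_left_filter/cF.
- move=> x _; rewrite derive1E.
  have H : is_derive x 1 (fun t : R => (t - c) ^+ 2 / 2) (x - c).
    apply: is_derive_eq; rewrite /GRing.scale/=; by field.
  by apply: derive_val.
Qed.

(** * Independence of a term from its past *)

Section Past.
Context {R : realType} d {T : measurableType d} (P : probability T R).
Variable Y : nat -> {RV P >-> R}.
Local Open Scope ereal_scope.

Definition cylinders n : set (set T) :=
  [set \bigcap_(k in `I_n) (Y k @^-1` B k) | B in
    [set B : nat -> set R | forall i, measurable (B i)]].

Lemma measurable_RV_preimage k (B : set R) : measurable B ->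
  measurable (Y k @^-1` B).
Proof. by move=> mB; rewrite -[_ @^-1` _]setTI; exact: measurable_funP. Qed.

Lemma mutually_independent_ord n (B : nat -> set R) :
  mutually_independent Y -> (forall i, measurable (B i)) ->
  P (\bigcap_(k in `I_n) (Y k @^-1` B k)) = \prod_(k < n) P (Y k @^-1` B k).
Proof.
move=> indY mB; have := indY [fset k | k in iota 0 n]%fset B mB.
have -> : [set` [fset k | k in iota 0 n]%fset] = `I_n.
  by apply/seteqP; split => k /=; rewrite !inE/= mem_iota.
move=> ->; rewrite -(big_mkord xpredT (fun k => P (Y k @^-1` B k))).
apply: perm_big; apply: uniq_perm; [exact: fset_uniq|exact: iota_uniq|].
by move=> k; rewrite !inE/= mem_index_iota mem_iota.
Qed.

Lemma cylinders_setI n : setI_closed (cylinders n).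
Proof.
move=> _ _ [A mA <-] [B mB <-]; exists (fun k => A k `&` B k).
  by move=> k; exact: measurableI.
rewrite -bigcapI; apply: eq_bigcapr => k _; exact: preimage_setI.
Qed.

Lemma cylinders_measurable n : <<s cylinders n >> `<=` measurable.
Proof.
apply: smallest_sub; first exact: sigma_algebra_measurable.
move=> _ [B mB <-]; rewrite bigcap_mkord.
by apply: bigsetI_measurable => k _; exact: measurable_RV_preimage.
Qed.

(** Dynkin's pi-lambda argument: the events independent of a fixed event form a lambda-system, and
    this one contains the cylinders. *)
Lemma cylinders_indep n (C : set R) A : mutually_independent Y ->
  measurable C -> <<s cylinders n >> A ->
  P (A `&` Y n @^-1` C) = P A * P (Y n @^-1` C).
Proof.
move=> indY mC; set E := Y n @^-1` C.
have mE : measurable E by exact: measurable_RV_preimage.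
pose H := [set A | measurable A /\ P (A `&` E) = P A * P E].
suff : <<s cylinders n >> `<=` H by move=> + sA => /(_ _ sA)[].
apply: lambda_system_subset => //; first exact: cylinders_setI.
- split => //.
  + by split; [exact: measurableT|rewrite setTI probability_setT mul1e].
  + move=> A1 A2 A21 [mA1 PA1] [mA2 PA2]; split; first exact: measurableD.
    have -> : (A1 `\` A2) `&` E = (A1 `&` E) `\` A2.
      by rewrite !setDE setIAC.
    have mA1E : measurable (A1 `&` E) by exact: measurableI.
    have PD B : measurable B -> P (B `\` A2) = P B - P (B `&` A2).
      by move=> mB; apply: measureD; rewrite // ltey_eq fin_num_measure.
    rewrite (PD _ mA1E) (PD _ mA1).
    have -> : A1 `&` E `&` A2 = A2 `&` E by rewrite setIAC (setIidr A21).
    rewrite (setIidr A21) PA1 PA2 muleBl//; first exact: fin_num_measure.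
    by apply: fin_num_adde_defr; exact: fin_num_measure.
  + move=> F ndF HF.
    have mF i : measurable (F i) by have [] := HF i.
    have mUF : measurable (\bigcup_i F i) by exact: bigcup_measurable.
    split => //; rewrite setI_bigcupl.
    have c1 : P \o (fun i => F i `&` E) @ \oo --> P (\bigcup_i (F i `&` E)).
      apply: nondecreasing_cvg_mu.
      - by move=> i; exact: measurableI.
      - by apply: bigcup_measurable => i _; exact: measurableI.
      - by move=> i j ij; apply/subsetPset; apply: setSI; exact/subsetPset/ndF.
    have c2 : P \o (fun i => F i `&` E) @ \oo --> P (\bigcup_i F i) * P E.
      have -> : P \o (fun i => F i `&` E) = fun i => (P \o F) i * P E.
        by apply/funext => i /=; have [] := HF i.
      apply: cvgeZr; first by rewrite fin_num_measure.
      exact: nondecreasing_cvg_mu.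
    exact: cvg_unique c1 c2.
- move=> _ [B mB <-]; split.
    rewrite bigcap_mkord.
    by apply: bigsetI_measurable => k _; exact: measurable_RV_preimage.
  (* With [C] as the constraint at index [n], the intersection with [E] is itself a longer
     cylinder. *)
  pose B' k := if (k < n)%N then B k else C.
  have mB' k : measurable (B' k) by rewrite /B'; case: ifP.
  have -> : \bigcap_(k in `I_n) (Y k @^-1` B k) `&` E =
      \bigcap_(k in `I_n.+1) (Y k @^-1` B' k).
    rewrite bigcap_mkord bigcap_mkord big_ord_recr/= /B' ltnn; congr (_ `&` _).
    by apply: eq_bigr => k _; rewrite ltn_ord.
  rewrite !mutually_independent_ord// big_ord_recr/= /B' ltnn; congr (_ * _).
  by apply: eq_bigr => k _; rewrite ltn_ord.
Qed.

Lemma measurable_past k n : (k < n)%N ->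
  measurable_fun (setT : set (g_sigma_algebraType (cylinders n)))
    (Y k : _ -> R).
Proof.
move=> kn _ B mB; rewrite setTI; apply: sub_sigma_algebra.
exists (fun i => if i == k then B else setT).
  by move=> i; case: ifP => // _; exact: measurableT.
apply/seteqP; split => [w /(_ k kn)/=|w Bw i _ /=]; first by rewrite eqxx.
by case: eqP => // ->.
Qed.

Lemma measurable_process k :
  measurable_fun (setT : set (g_sigma_algebraType
    (\bigcup_i preimage_set_system setT (Y i) measurable))) (Y k : _ -> R).
Proof.
move=> _ B mB; apply: sub_sigma_algebra; exists k => //.
by exists B.
Qed.

(** A function of the past of [Y n] is independent of [Y n]. Wald's identity rests on this. *)
Lemma expectation_mul_past n (f : T -> R) (g : R -> R) :
  mutually_independent Y ->
  measurable_fun (setT : set (g_sigma_algebraType (cylinders n))) f ->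
  measurable_fun setT g -> (forall w, 0 <= f w)%R ->
  (forall w, 0 <= g (Y n w))%R ->
  \int[P]_w (f w * g (Y n w))%:E
  = \int[P]_w (f w)%:E * \int[P]_w (g (Y n w))%:E.
Proof.
move=> indY mf mg f0 g0.
apply: (@expectation_mul_indep _ _ _ _ f (g \o Y n)) => //.
- move=> mT B mB; apply: (@cylinders_measurable n); exact: mf.
- exact: measurableT_comp.
- move=> A B mA mB; apply: (@cylinders_indep n (g @^-1` B) (f @^-1` A)) => //.
  + by rewrite -[_ @^-1` _]setTI; exact: mg.
  + by rewrite -[_ @^-1` _]setTI; exact: mf.
Qed.

Lemma has_law_integral (F : probability R R) (f : R -> \bar R) i :
  has_law Y F -> measurable_fun setT f ->
  \int[P]_w f (Y i w) = \int[F]_x f x.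
Proof.
move=> lawY mf.
have eqm : forall g : R -> \bar R,
    \int[distribution P (Y i)]_x g x = \int[F]_x g x.
  by move=> g; apply: eq_measure_integral => A mA _; exact: lawY.
rewrite [LHS]integralE [RHS]integralE -!eqm.
rewrite ge0_integral_distribution//; last exact: measurable_funepos.
rewrite ge0_integral_distribution//.
- by congr (_ - _); apply: eq_integral => x _; rewrite /= ?funeposE ?funenegE.
- exact: measurable_funeneg.
Qed.

Lemma mutually_independent_run (F : probability R R) (B : set R) j i :
  iid Y F -> measurable B -> (j <= i)%N ->
  P (\bigcap_(k in [set k | j <= k < i]%N) (Y k @^-1` B)) =
  (fine (F B) ^+ (i - j))%:E.
Proof.
move=> [indY lawY] mB ji.
(* Indices below [j] get the trivial constraint [setT], whose factor is 1, so that independence over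
   an initial segment applies. *)
pose B' k := if (j <= k)%N then B else setT.
have mB' k : measurable (B' k) by rewrite /B'; case: ifP.
have -> : \bigcap_(k in [set k | j <= k < i]%N) (Y k @^-1` B) =
    \bigcap_(k in `I_i) (Y k @^-1` B' k).
  apply/seteqP; split => w /= Bw k /=.
    move=> ki; rewrite /B'; case: ifPn => // jk; apply: (Bw k).
    by rewrite /= jk.
  by move=> /andP[jk ki]; have := Bw k ki; rewrite /B' jk.
rewrite mutually_independent_ord//.
rewrite -(big_mkord xpredT (fun k => P (Y k @^-1` B' k))).
rewrite (big_cat_nat (leq0n j) ji)/=.
rewrite [X in X * _]big_nat_cond big1 ?mul1e; last first.
  move=> k /andP[/andP[_ kj] _]; rewrite /B' leqNgt kj preimage_setT.
  exact: probability_setT.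
rewrite big_nat_cond (eq_bigr (fun=> (fine (F B))%:E)); last first.
  move=> k /andP[/andP[jk _] _]; rewrite /B' jk fineK ?fin_num_measure//.
  exact: lawY.
by rewrite -big_nat_cond prodEFin prodr_const_nat.
Qed.

End Past.

(** * Pathwise estimates for renewal sums *)

Section Renewal_sums.
Context {R : realType} (x : nat -> R).
Hypothesis x_ge0 : forall i, 0 <= x i.

(** With [x] the inter-generation times, this is the start of period [n]. Packet [n] is generated at
    the end of that period, since indices start at 0. *)
Definition partial_sum n : R := \sum_(k < n) x k.

Lemma partial_sumS n : partial_sum n.+1 = partial_sum n + x n.
Proof. by rewrite /partial_sum big_ord_recr. Qed.

Lemma partial_sum_ge0 n : 0 <= partial_sum n.
Proof. by apply: sumr_ge0. Qed.

Lemma partial_sum_le m n : (m <= n)%N -> partial_sum m <= partial_sum n.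
Proof.
apply: (@homo_leq _ partial_sum (fun a b => a <= b)) => //.
  by move=> ? ? ?; exact: le_trans.
by move=> i; rewrite partial_sumS lerDl.
Qed.

(* The bound [t + c] is inductive only together with [partial_sum n]. *)
Lemma truncated_renewal_sum_le (t c : R) n : 0 <= t -> 0 <= c ->
  \sum_(i < n) (partial_sum i <= t)%R%:R * Num.min (x i) c <= t + c.
Proof.
move=> t0 c0; suff : \sum_(i < n) (partial_sum i <= t)%R%:R * Num.min (x i) c
    <= Num.min (partial_sum n) (t + c) by rewrite le_min => /andP[].
elim: n => [|n IH].
  by rewrite big_ord0 le_min partial_sum_ge0 addr_ge0.
rewrite big_ord_recr/= partial_sumS.
move: IH; rewrite !le_min => /andP[IH1 IH2].
have := x_ge0 n; have := ge_min (x n) (x n) c; have := ge_min c (x n) c.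
rewrite !lexx orbT => m1 m2 xn.
case: (leP (partial_sum n) t) => st; rewrite ?mul1r ?mul0r.
  by apply/andP; split; lra.
by apply/andP; split; lra.
Qed.

(* The summand [e] takes care of the case where all partial sums are at most
   [t]: the series is then infinite. *)
Lemma renewal_sum_ge (t e : R) : 0 <= t -> 0 < e ->
  (t%:E <= \sum_(0 <= i <oo) ((partial_sum i <= t)%R%:R * (x i + e))%:E)%E.
Proof.
move=> t0 e0.
have u0 i : (0 <= ((partial_sum i <= t)%R%:R * (x i + e))%:E)%E.
  by rewrite lee_fin mulr_ge0// addr_ge0// ltW.
suff [n tn] : exists n, t <= \sum_(i < n) (partial_sum i <= t)%R%:R * (x i + e).
  apply: (le_trans _ (nneseries_lim_ge n _)) => //.
  by rewrite sumEFin lee_fin big_mkord.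
have [[n sn]|none] := pselect (exists n, t < partial_sum n).
  pose m := ex_minn (ex_intro (fun n => t < partial_sum n) n sn).
  have [sm minm] :
      t < partial_sum m /\ forall k, t < partial_sum k -> (m <= k)%N.
    by rewrite /m; case: ex_minnP.
  exists m; apply: (le_trans (ltW sm)); apply: ler_sum => i _.
  have -> : partial_sum i <= t.
    by rewrite leNgt; apply/negP => /minm; rewrite leqNgt ltn_ord.
  by rewrite mul1r lerDl ltW.
have st i : partial_sum i <= t.
  by rewrite leNgt; apply/negP => ?; apply: none; exists i.
exists (Num.bound (t / e)).
apply: (@le_trans _ _ (\sum_(i < (Num.bound (t / e))) e)).
  rewrite sumr_const card_ord -[e *+ _]mulr_natl -ler_pdivrMr//.
  by apply/ltW/archi_boundP; rewrite divr_ge0// ltW.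
by apply: ler_sum => i _; rewrite st mul1r lerDr.
Qed.

(** The partial sums are nondecreasing, so at most one index has
    [partial_sum i <= t < partial_sum i.+1], the period running at time [t]; it costs at most
    [M]. *)
Lemma renewal_sum_shift (t : R) (q : nat -> R) (M : R) n : 0 <= M ->
  (forall i, 0 <= q i <= M) ->
  \sum_(i < n) (partial_sum i <= t)%R%:R * q i
  <= \sum_(i < n) (partial_sum i.+1 <= t)%R%:R * q i + M.
Proof.
(* The inductive form charges [M] only after some partial sum has passed [t], hence only once. *)
move=> M0 qM; suff : \sum_(i < n) (partial_sum i <= t)%R%:R * q i
    <= \sum_(i < n) (partial_sum i.+1 <= t)%R%:R * q i
       + (t < partial_sum n)%R%:R * M.
  move=> /le_trans; apply; rewrite lerD2l.
  by case: (t < _); rewrite ?mul1r ?mul0r.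
elim: n => [|n IH]; first by rewrite !big_ord0 add0r mulr_ge0.
rewrite !big_ord_recr/=; have /andP[q0 q1] := qM n.
have := partial_sum_le (leqnSn n).
move: IH; case: (leP (partial_sum n) t); case: (leP (partial_sum n.+1) t) => /=;
  rewrite ?mul1r ?mul0r => *; lra.
Qed.

End Renewal_sums.

(** * Staleness at the start of a period *)

Section Staleness.
Context {R : realType} (a0 : R) (b : nat -> R) (x : nat -> R).

(* With [b k] the indicator that packet [k] is late, this is the age, at the
   generation of packet [n], of the last earlier packet that is not late. The
   weights are real because the expectation obeys the same recursion with [b k]
   the probability of being late. *)
Fixpoint staleness n : R :=
  if n is m.+1 then b m * (staleness m + x m) else a0.

Lemma staleness_ge0 n : 0 <= a0 -> (forall i, 0 <= b i) ->
  (forall i, 0 <= x i) -> 0 <= staleness n.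
Proof.
by move=> a0_ge0 b_ge0 x_ge0; elim: n => //= n IH; rewrite mulr_ge0// addr_ge0.
Qed.

(** For indicator weights, period [j] counts at index [n] exactly when packets [j] to [n - 1] are
    all late, and the initial age when all packets before [n] are. *)
Lemma stalenessE n : staleness n =
  a0 * \prod_(0 <= k < n) b k
  + \sum_(j < n) x j * \prod_(j <= k < n) b k.
Proof.
elim: n => [|n IH] /=; first by rewrite big_geq// big_ord0 mulr1 addr0.
rewrite IH big_ord_recr/= big_nat_recr//= big_nat1.
have -> : \sum_(j < n) x j * \prod_(j <= k < n.+1) (b k) =
    (\sum_(j < n) x j * \prod_(j <= k < n) b k) * b n.
  rewrite mulr_suml; apply: eq_bigr => j _.
  by rewrite big_nat_recr ?mulrA//= ltnW.
ring.
Qed.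

End Staleness.

(** * Pathwise bounds on the age *)

Section Age_bounds.
Context {R : realType} d {T : measurableType d} (P : probability T R).
Variables (X S : nat -> {RV P >-> R}) (a0 : R) (w : T).
Hypotheses (a0_ge0 : 0 <= a0) (X_gt0 : forall i, 0 < X i w)
  (S_ge0 : forall i, 0 <= S i w).

Local Notation s := (partial_sum (X ^~ w)).
Let X_ge0 i : 0 <= X i w := ltW (X_gt0 i).

Lemma age_has_lbound (t : R) : 0 <= t ->
  has_lbound
    ([set a0 + t] `|` [set t - gen_time X i w | i in received X S t w]).
Proof.
move=> t0; exists 0 => _ [->|[i /= it <-]]; first by rewrite addr_ge0.
by rewrite subr_ge0; apply: le_trans it; rewrite lerDl.
Qed.

Lemma le_age (t v : R) : v <= a0 + t ->
  (forall i, received X S t w i -> v <= t - gen_time X i w) ->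
  v <= age X S a0 t w.
Proof.
move=> v0 vi; apply: lb_le_inf; first by exists (a0 + t); left.
by move=> _ [->|[i /= it <-]] //; exact: vi.
Qed.

Lemma age_ge0 (t : R) : 0 <= t -> 0 <= age X S a0 t w.
Proof.
move=> t0; apply: le_age; first by rewrite addr_ge0.
move=> i it; rewrite subr_ge0; apply: le_trans it; by rewrite lerDl.
Qed.

Lemma age_le_initial (t : R) : 0 <= t -> age X S a0 t w <= a0 + t.
Proof. by move=> t0; apply: ge_inf; [exact: age_has_lbound|left]. Qed.

Lemma age_le_received (t : R) i : 0 <= t -> recv_time X S i w <= t ->
  age X S a0 t w <= t - gen_time X i w.
Proof.
by move=> t0 it; apply: ge_inf; [exact: age_has_lbound|right; exists i].
Qed.

(** A packet received by time [t] was generated by then, and none is generated strictly between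
    [s i] and [s i.+1]. *)
Lemma age_ge_elapsed i (t : R) : s i <= t < s i.+1 -> t - s i <= age X S a0 t w.
Proof.
move=> /andP[sit tsi]; have si0 : 0 <= s i by exact: partial_sum_ge0.
apply: le_age => [|j jt]; first by move: a0_ge0 si0; lra.
(* Packet [j] is generated at [s j.+1], so [j < i] is what has to be shown. *)
rewrite lerD2l lerN2; apply: (@partial_sum_le _ _ X_ge0 j.+1 i).
rewrite ltnNge -ltnS; apply/negP => ij.
have := partial_sum_le X_ge0 ij.
have : s j.+1 + S j w <= t := jt.
have := S_ge0 j; lra.
Qed.

(** Induction on [i]. If packet [i] is on time, it has arrived by [s i.+1 + delta] and the staleness
    restarts at 0. If it is late, the bound for [i] carries over, the staleness having grown by
    [X i w]. *)
Lemma age_le_staleness (delta : R) i (t : R) : 0 <= delta -> s i + delta <= t ->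
  age X S a0 t w
  <= staleness a0 (fun k => (delta < S k w)%R%:R) (X ^~ w) i + (t - s i).
Proof.
move=> delta0; elim: i => [|i IH] sit.
  rewrite /= /partial_sum big_ord0 subr0; apply: age_le_initial.
  by have := partial_sum_ge0 X_ge0 0; lra.
have si0 : 0 <= s i.+1 by exact: partial_sum_ge0.
have t0 : 0 <= t by lra.
have sS : s i.+1 = s i + X i w by exact: partial_sumS.
rewrite /=; case: ltP => Si; rewrite ?mul1r ?mul0r.
  have := X_ge0 i; have := IH; rewrite sS in sit *; lra.
rewrite add0r; apply: age_le_received => //.
change (s i.+1 + S i w <= t); lra.
Qed.

End Age_bounds.

(** * Pathwise bounds on the time integral of the age *)

Section Age_integral.
Context {R : realType} d {T : measurableType d} (P : probability T R).
Variables (X S : nat -> {RV P >-> R}) (a0 : R) (w : T).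
Hypotheses (a0_ge0 : 0 <= a0) (X_gt0 : forall i, 0 < X i w)
  (S_ge0 : forall i, 0 <= S i w).

Local Notation s := (partial_sum (X ^~ w)).
Local Notation leb := (@lebesgue_measure R).
Let X_ge0 i : 0 <= X i w := ltW (X_gt0 i).

Let measurable_affine (D : set R) (c : R) :
  measurable_fun D (fun t : R => (t - c)%:E).
Proof.
apply: (@measurable_funS _ _ _ _ setT) => //.
by apply/measurable_EFinP; exact: measurable_funB.
Qed.

(** On this interval the age lies between 0 and [a0 + t]. Hence [fine] loses nothing when the time
    integral is read as a real number. *)
Lemma integral_age_fin_num (t : R) : 0 <= t ->
  (\int[leb]_(u in `[0%R, t]) (age X S a0 u w)%:E \is a fin_num)%E.
Proof.
move=> t0; rewrite ge0_fin_numE; last first.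
  apply: integral_ge0 => u /=; rewrite in_itv/= => /andP[u0 _].
  by rewrite lee_fin; exact: age_ge0.
apply: (@le_lt_trans _ _ (\int[leb]_(u in `[0%R, t]) (a0 + t)%:E)%E).
  apply: ge0_integral_mono => u /=; rewrite in_itv/= => /andP[u0 ut].
    by rewrite lee_fin; exact: age_ge0.
  by rewrite lee_fin (le_trans (age_le_initial X a0_ge0 S_ge0 u0))// lerD2l.
rewrite integral_cst//= lebesgue_measure_itv/=.
by case: ifPn => _; rewrite ?mule0 ?ltry// -EFinD -EFinM ltry.
Qed.

(** The half-open periods are disjoint, so at most one summand is nonzero at [u], and
    [age_ge_elapsed] bounds it. *)
Lemma age_ge_sum_elapsed (u : R) n : 0 <= u ->
  (\sum_(i < n) ((fun t => (t - s i)%:E) \_ `[s i, s i.+1[) u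
   <= (age X S a0 u w)%:E)%E.
Proof.
move=> u0; have [[i ui]|none] := pselect (exists i : 'I_n, s i <= u < s i.+1).
  rewrite (bigD1 i)//= big1 ?adde0; last first.
    move=> j ji; rewrite patchE ifF//; apply/negbTE/negP.
    rewrite inE/= in_itv/= => uj.
    move: ji; rewrite neq_ltn => /orP[ji|ij].
      by have := partial_sum_le X_ge0 ji; lra.
    by have := partial_sum_le X_ge0 ij; lra.
  rewrite patchE ifT; last by rewrite inE/= in_itv.
  by rewrite lee_fin; exact: age_ge_elapsed.
rewrite big1 ?lee_fin; first by exact: age_ge0.
move=> i _; rewrite patchE ifF//; apply/negbTE/negP.
by rewrite inE/= in_itv/= => ui; apply: none; exists i.
Qed.

(** A completed period contributes [X i w ^+ 2 / 2]. The sum runs over all periods begun by time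
    [t], as Wald's identity wants; the truncation at [M] bounds the one still running. *)
Lemma integral_age_ge (t M : R) n : 0 <= t -> 0 <= M ->
  ((2^-1 * \sum_(i < n) (s i <= t)%R%:R * Num.min (X i w ^+ 2) M)%:E
   <= \int[leb]_(u in `[0%R, t]) (age X S a0 u w)%:E + (2^-1 * M)%:E)%E.
Proof.
move=> t0 M0.
apply: (@le_trans _ _ (((\sum_(i < n) (s i.+1 <= t)%R%:R * (X i w ^+ 2 / 2))%:E
    + (2^-1 * M)%:E)%E)).
  rewrite -EFinD lee_fin.
  apply: (@le_trans _ _ (2^-1 * (\sum_(i < n) (s i.+1 <= t)%R%:R
      * Num.min (X i w ^+ 2) M + M))).
    rewrite ler_pM2l//.
    apply: (@renewal_sum_shift _ _ X_ge0 t
      (fun i => Num.min (X i w ^+ 2) M)) => // i.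
    by rewrite le_min sqr_ge0 M0/= ge_min lexx orbT.
  rewrite mulrDr lerD2r mulr_sumr; apply: ler_sum => i _.
  rewrite mulrCA ler_wpM2l// mulrC ler_pM2r//.
  by rewrite ge_min lexx.
rewrite leeD2r//.
apply: (@le_trans _ _ (\int[leb]_(u in `[0%R, t])
    \sum_(i < n) ((fun t => (t - s i)%:E) \_ `[s i, s i.+1[) u)%E); last first.
  apply: ge0_integral_mono => u /=; rewrite in_itv/= => /andP[u0 ut].
    apply: sume_ge0 => i _; rewrite patchE; case: ifPn => //.
    by rewrite inE/= in_itv/= lee_fin subr_ge0 => /andP[].
  exact: age_ge_sum_elapsed.
rewrite ge0_integral_sum//; last 2 first.
- move=> i; apply: (@measurable_funS _ _ _ _ setT) => //.
  by apply: (measurable_restrictT _ _).1 => //; exact: measurable_affine.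
- move=> i u _; rewrite patchE; case: ifPn => //.
  by rewrite inE/= in_itv/= lee_fin subr_ge0 => /andP[].
rewrite -sumEFin; apply: lee_sum => i _.
rewrite -integral_mkcondr; case: (leP (s i.+1) t) => sit; last first.
  rewrite mul0r; apply: integral_ge0 => u [_] /=.
  by rewrite in_itv/= lee_fin subr_ge0 => /andP[].
rewrite mul1r (_ : _ `&` _ = `[s i, s i.+1[%classic); last first.
  apply: setIidr => u /=; rewrite !in_itv/= => /andP[su us].
  by have := partial_sum_ge0 X_ge0 i; lra.
rewrite integral_itv_bndo_bndc// integral_affine; last exact: partial_sum_le.
by rewrite lee_fin subrr expr0n subr0 partial_sumS addrC addKr.
Qed.

(* The last summand [delta] makes the series infinite when infinitely many
   packets are generated up to time [t]. *)
Lemma integral_age_le (t delta : R) : 0 <= t -> 0 < delta ->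
  (\int[leb]_(u in `[0%R, t]) (age X S a0 u w)%:E
   <= ((a0 + delta) * delta)%:E
      + \sum_(0 <= i <oo) ((s i <= t)%R%:R *
          ((staleness a0 (fun k => (delta < S k w)%R%:R) (X ^~ w) i + delta)
             * X i w + X i w ^+ 2 / 2 + delta))%:E)%E.
Proof.
move=> t0 delta0; set V := staleness _ _ _.
have V0 i : 0 <= V i by exact: staleness_ge0.
have v0 i : 0 <= (V i + delta) * X i w + X i w ^+ 2 / 2.
  by rewrite addr_ge0 ?mulr_ge0 ?addr_ge0 ?sqr_ge0// ltW.
have u0 i : (0 <= ((s i <= t)%R%:R *
    ((V i + delta) * X i w + X i w ^+ 2 / 2 + delta))%:E)%E.
  by rewrite lee_fin mulr_ge0// addr_ge0// ltW.
have [[n sn]|none] := pselect (exists n, t < s n); last first.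
  rewrite (_ : (\sum_(0 <= i <oo) _ = +oo)%E) ?addey ?leey//.
  have st i : s i <= t by rewrite leNgt; apply/negP => ?; apply: none; exists i.
  apply/eqyP => A A0.
  apply: (le_trans _ (nneseries_lim_ge (Num.bound (A / delta)) _)) => //.
  rewrite sumEFin lee_fin big_mkord.
  apply: (@le_trans _ _ (\sum_(i < Num.bound (A / delta)) delta)).
    rewrite sumr_const card_ord -[delta *+ _]mulr_natl -ler_pdivrMr//.
    by apply/ltW/archi_boundP; rewrite divr_ge0// ltW.
  by apply: ler_sum => i _; rewrite st mul1r lerDr.
apply: le_trans; last first.
  by apply: leeD2l; apply: (nneseries_lim_ge n) => i _ _; exact: u0.
(* Up to time [delta] the crude bound [a0 + delta] is used. The shifted periods [A i] cover the
   rest, and on [A i] the age is at most the staleness [V i] plus the time since [s i]. *)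
pose A i : set R := `[s i + delta, s i.+1 + delta]%classic.
pose h i := (fun u : R => (u - (s i - V i))%:E) \_ (A i).
have h0 i u : (0 <= h i u)%E.
  rewrite /h patchE; case: ifPn => //; rewrite inE /A/= in_itv/= => /andP[su _].
  by rewrite lee_fin; have := V0 i; lra.
have mA i : measurable (A i) by exact: measurable_itv.
apply: (@le_trans _ _ (\int[leb]_(u in `[0%R, t])
    (((cst (a0 + delta)%:E) \_ `[0%R, delta]) u + \sum_(i < n) h i u))%E).
  apply: ge0_integral_mono => u /=; rewrite in_itv/= => /andP[u0' ut].
    by rewrite lee_fin; exact: age_ge0.
  have [ud|du] := leP u delta.
    rewrite patchE ifT; last by rewrite inE/= in_itv/= u0' ud.
    apply: (@le_trans _ _ (a0 + delta)%:E).
      by rewrite lee_fin (le_trans (age_le_initial X a0_ge0 S_ge0 u0'))// lerD2l.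
    by rewrite leeDl// sume_ge0.
  have un : u < s n + delta by lra.
  (* The least such index is positive because [delta < u], and [u] lies in the window of its
     predecessor. *)
  pose m := ex_minn (ex_intro (fun n => u < s n + delta) n un).
  have [um minm] : u < s m + delta /\ forall k, u < s k + delta -> (m <= k)%N.
    by rewrite /m; case: ex_minnP.
  have mn := minm _ un.
  case: m um minm mn => [|m] um minm mn.
    by exfalso; move: um; rewrite /partial_sum big_ord0; lra.
  have sm : s m + delta <= u.
    by rewrite leNgt; apply/negP => /minm; rewrite ltnn.
  apply: (@le_trans _ _ (h m u)).
    rewrite /h patchE ifT; last by rewrite inE /A/= in_itv/= sm ltW.
    rewrite lee_fin opprB addrCA.
    by apply: age_le_staleness => //; exact: ltW.
  rewrite (bigD1 (Ordinal mn))//= addeCA leeDl// adde_ge0//.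
    by rewrite patchE; case: ifP => // _; rewrite lee_fin addr_ge0// ltW.
  exact: sume_ge0.
have mh i : measurable_fun setT (h i).
  by apply: (measurable_restrictT _ _).1 => //; exact: measurable_affine.
have mc : measurable_fun setT ((cst (a0 + delta)%:E) \_ `[0%R, delta]).
  by apply: (measurable_restrictT _ _).1 => //; exact: measurable_cst.
have ms : measurable_fun setT (fun u => \sum_(i < n) h i u)%E.
  by apply: emeasurable_sum => i; exact: mh.
rewrite ge0_integralD//; last 4 first.
- by move=> u _; rewrite patchE; case: ifP => // _; rewrite lee_fin addr_ge0// ltW.
- exact: measurable_funS mc.
- by move=> u _; exact: sume_ge0.
- exact: measurable_funS ms.
apply: leeD.
  rewrite -integral_mkcondr integral_cst; last exact: measurableI.
  rewrite EFinM lee_wpmul2l//; first by rewrite lee_fin addr_ge0// ltW.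
  apply: le_trans (le_measure _ _ _ (@subIsetr _ _ _)) _; rewrite ?inE//.
    exact: measurableI.
  by rewrite /= lebesgue_measure_itv/= lte_fin delta0 sube0.
rewrite ge0_integral_sum//; last by move=> i; exact: measurable_funS (mh i).
rewrite big_mkord; apply: lee_sum => i _.
rewrite /h -integral_mkcondr; case: (leP (s i) t) => sit; last first.
  rewrite mul0r (_ : _ `&` _ = set0) ?integral_set0//.
  apply/seteqP; split => u //= [] /=.
  rewrite /A /= !in_itv/= => /andP[_ ut] /andP[su _].
  by move: ut su sit delta0; lra.
rewrite mul1r.
apply: (@le_trans _ _ (\int[leb]_(u in A i) (u - (s i - V i))%:E)%E).
  apply: ge0_subset_integral; [| | | |exact: subIsetr].
  - by apply: measurableI; [exact: measurable_itv|exact: mA].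
  - exact: mA.
  - exact: measurable_affine.
  - by move=> u; rewrite /A/= in_itv/= lee_fin; have := V0 i; lra.
rewrite integral_affine; last by rewrite lerD2r; exact: partial_sum_le.
rewrite lee_fin partial_sumS.
set b := s i; set v := V i; set y := X i w.
(* Over the window the bound on the age grows from [v + delta] to [v + delta + y]. *)
rewrite (_ : _ / 2 = (v + delta) * y + y ^+ 2 / 2); last by field.
by rewrite lerDl ltW.
Qed.

End Age_integral.

(** * Wald's identity and the renewal function *)

Lemma nneseries_le_partial {R : realType} (u : (\bar R)^nat) (b : \bar R) :
  (forall i, 0 <= u i)%E -> (forall n, \sum_(i < n) u i <= b)%E ->
  (\sum_(0 <= i <oo) u i <= b)%E.
Proof.
move=> u0 ub; apply: lime_le; first exact: is_cvg_nneseries.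
by apply: nearW => n; rewrite big_mkord.
Qed.

Lemma measurable_natr_bool {R : realType} d (T : measurableType d)
    (b : T -> bool) :
  measurable_fun setT b -> measurable_fun setT (fun w => (b w)%:R : R).
Proof.
move=> mb; rewrite (_ : (fun w => _) = (fun w => if b w then 1 else 0)).
  exact: measurable_fun_ifT.
by apply/funext => w; case: (b w).
Qed.

Section Wald.
Context {R : realType} d {T : measurableType d} (P : probability T R).
Variables (X S : nat -> {RV P >-> R}) (FX FS : probability R R).
Hypothesis queue : GGinf_queue X S FX FS.
Local Open Scope ereal_scope.

Local Notation s i w := (partial_sum (X ^~ w) i).

Let X_gt0 i w : (0 < X i w)%R. Proof. by case: queue. Qed.
Let X_ge0 i w : (0 <= X i w)%R. Proof. exact: ltW. Qed.

Definition active (t : R) i : T -> R := fun w => (s i w <= t)%R%:R.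

(** Only the lengths before index [i] enter the start of period [i], so whether it has begun by time
    [t] is decided by the past of [X i]. *)
Lemma measurable_active_past t i :
  measurable_fun (setT : set (g_sigma_algebraType (cylinders X i)))
    (active t i).
Proof.
apply: measurable_natr_bool; apply: measurable_fun_ler => //.
by apply: measurable_sum => k; exact: measurable_past.
Qed.

Lemma measurable_active t i : measurable_fun setT (active t i).
Proof.
apply: measurable_natr_bool; apply: measurable_fun_ler => //.
exact: measurable_sum.
Qed.

Definition active_prob t i : R := fine (\int[P]_w (active t i w)%:E).

Lemma active_probE t i : \int[P]_w (active t i w)%:E = (active_prob t i)%:E.
Proof.
rewrite /active_prob fineK// ge0_fin_numE; last first.
  by apply: integral_ge0 => w _; rewrite lee_fin.
apply: (@le_lt_trans _ _ (\int[P]_w (cst 1 w))).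
  by apply: ge0_integral_mono => w _; rewrite lee_fin// /active lern1 leq_b1.
by rewrite integral_cst//= probability_setT mule1 ltry.
Qed.

Lemma active_prob_ge0 t i : (0 <= active_prob t i)%R.
Proof. by apply: fine_ge0; apply: integral_ge0 => w _; rewrite lee_fin. Qed.

Lemma active_prob_le1 t i : (active_prob t i <= 1)%R.
Proof.
rewrite -lee_fin -active_probE.
apply: (@le_trans _ _ (\int[P]_w (cst 1 w))).
  by apply: ge0_integral_mono => w _; rewrite lee_fin// /active lern1 leq_b1.
by rewrite integral_cst//= probability_setT mule1.
Qed.

Lemma integral_law (g : R -> R) i : measurable_fun setT g ->
  \int[P]_w (g (X i w))%:E = \int[FX]_x (g x)%:E.
Proof.
move=> mg; case: queue => _ _ [_ lawX] _ _.
by rewrite (has_law_integral (f := EFin \o g) i lawX)//; exact/measurable_EFinP.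
Qed.

Lemma Wald_term t i (g : R -> R) : measurable_fun setT g ->
  (forall x, 0 <= x -> 0 <= g x)%R ->
  \int[P]_w (active t i w * g (X i w))%:E
  = (active_prob t i)%:E * \int[FX]_x (g x)%:E.
Proof.
move=> mg g0; case: (queue) => _ _ [indX _] _ _.
rewrite (expectation_mul_past indX)//; last 2 first.
- exact: measurable_active_past.
- by move=> w; exact: g0.
by rewrite active_probE integral_law.
Qed.

(** The renewal function: the expected number of periods begun by time [t]. It is extended-real
    because its finiteness is not known beforehand. *)
Definition expected_active t : \bar R := \sum_(0 <= i <oo) (active_prob t i)%:E.

(** Monotone convergence reduces this to [Wald_term]; as the integral of [g] is finite, it can be
    pulled out of the series. *)
Lemma Wald t (g : R -> R) : measurable_fun setT g ->
  (forall x, 0 <= x -> 0 <= g x)%R -> \int[FX]_x (g x)%:E \is a fin_num ->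
  \int[P]_w \sum_(0 <= i <oo) (active t i w * g (X i w))%:E
  = expected_active t * \int[FX]_x (g x)%:E.
Proof.
move=> mg g0 fg; rewrite integral_nneseries//; last 2 first.
- move=> i; apply/measurable_EFinP; apply: measurable_funM.
    exact: measurable_active.
  exact: measurableT_comp.
- by move=> i w _; rewrite lee_fin mulr_ge0// g0.
rewrite /expected_active -(fineK fg) muleC -nneseriesZl; last first.
  by move=> i _; rewrite lee_fin active_prob_ge0.
by apply: eq_eseriesr => i _; rewrite Wald_term// (fineK fg) muleC.
Qed.

Lemma truncated_mean_fin_num (c : R) : (0 <= c)%R ->
  \int[FX]_x (Num.min x c)%:E \is a fin_num.
Proof.
move=> c0; rewrite -(@integral_law (fun x => Num.min x c) 0%N); last first.
  exact: measurable_minr.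
rewrite ge0_fin_numE; last first.
  by apply: integral_ge0 => w _; rewrite lee_fin le_min X_ge0.
apply: (@le_lt_trans _ _ (\int[P]_w (cst c%:E w))).
  apply: ge0_integral_mono => w _; first by rewrite lee_fin le_min X_ge0.
  by rewrite lee_fin ge_min lexx orbT.
by rewrite integral_cst//= probability_setT mule1 ltry.
Qed.

(** Wald's identity for [Num.min x c], whose renewal sum is at most [t + c] on every path. *)
Lemma expected_active_le (t c : R) : (0 <= t)%R -> (0 <= c)%R ->
  expected_active t * \int[FX]_x (Num.min x c)%:E <= (t + c)%:E.
Proof.
move=> t0 c0.
rewrite -(@Wald t (fun x => Num.min x c)); last 3 first.
- exact: measurable_minr.
- by move=> x x0; rewrite le_min x0.
- exact: truncated_mean_fin_num.
apply: (@le_trans _ _ (\int[P]_w (cst (t + c)%:E w))); last first.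
  by rewrite integral_cst//= probability_setT mule1.
apply: ge0_integral_mono => w _.
  by apply: nneseries_ge0 => i _ _; rewrite lee_fin mulr_ge0// le_min X_ge0.
apply: nneseries_le_partial => [i|n].
  by rewrite lee_fin mulr_ge0// le_min X_ge0.
by rewrite sumEFin lee_fin; exact: truncated_renewal_sum_le.
Qed.

(** Wald's identity for [x + e], whose renewal sum is at least [t] on every path, even one where
    infinitely many periods begin by time [t]. *)
Lemma expected_active_ge (t e : R) : \int[FX]_x x%:E \is a fin_num ->
  (0 <= t)%R -> (0 < e)%R ->
  t%:E <= expected_active t * (\int[FX]_x x%:E + e%:E).
Proof.
move=> EX t0 e0.
have EXe : \int[FX]_x x%:E + e%:E = \int[FX]_x (`|x| + e)%:E.
  rewrite -(@integral_law id 0%N)// -(@integral_law (fun x => `|x| + e)%R 0%N)//.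
    under [RHS]eq_integral do rewrite ger0_norm// EFinD.
    rewrite ge0_integralD//.
    - by rewrite integral_cst//= probability_setT mule1.
    - by move=> w _; rewrite lee_fin.
    - exact/measurable_EFinP.
    - by move=> w _; rewrite lee_fin ltW.
  by apply: measurable_funD => //; exact: normr_measurable.
rewrite EXe -(@Wald t (fun x => `|x| + e)%R); last 3 first.
- by apply: measurable_funD => //; exact: normr_measurable.
- by move=> x _; rewrite addr_ge0// ltW.
- by rewrite -EXe fin_numD EX.
apply: (@le_trans _ _ (\int[P]_w (cst t%:E w))).
  by rewrite integral_cst//= probability_setT mule1.
apply: ge0_integral_mono => w _; first by rewrite lee_fin.
under eq_eseriesr do rewrite ger0_norm//.
exact: renewal_sum_ge.
Qed.

End Wald.

(** * Limits superior at infinity and the lower bound on the average age *)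

Lemma limf_esup_pinfty_ge {R : realType} (f : R -> \bar R) (y : \bar R) :
  (forall K : R, exists2 t, K < t & (y <= f t)%E) ->
  (y <= limf_esup f (pinfty_nbhs R))%E.
Proof.
move=> yf; apply: le_ereal_inf_tmp => _ [V [N [_ NV]] <-].
have [t Nt yt] := yf N; apply: (le_trans yt); apply: ereal_sup_ubound.
by exists t => //; exact: NV.
Qed.

Lemma limf_esup_pinfty_le {R : realType} (f : R -> \bar R) (y : \bar R) (K : R) :
  (forall t, K < t -> (f t <= y)%E) -> (limf_esup f (pinfty_nbhs R) <= y)%E.
Proof.
move=> fy; apply: (@le_trans _ _ (ereal_sup (f @` [set t | K < t]))).
  apply: ereal_inf_lbound; exists [set t | K < t] => //.
  by exists K; split => //; exact: num_real.
by apply: ge_ereal_sup => _ [t Kt <-]; exact: fy.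
Qed.

Section Lower_bound.
Context {R : realType} d {T : measurableType d} (P : probability T R).
Variables (X S : nat -> {RV P >-> R}) (FX FS : probability R R) (a0 : R).
Hypotheses (queue : GGinf_queue X S FX FS) (a0_ge0 : 0 <= a0).
Local Open Scope ereal_scope.

Let X_gt0 i w : (0 < X i w)%R. Proof. by case: queue. Qed.
Let S_ge0 i w : (0 <= S i w)%R. Proof. by case: queue. Qed.

Definition age_integral (t : R) (w : T) : R :=
  Rintegral lebesgue_measure `[0%R, t] (fun u => age X S a0 u w).

Lemma age_integralK (t : R) w : (0 <= t)%R ->
  (age_integral t w)%:E
  = \int[lebesgue_measure]_(u in `[0%R, t]) (age X S a0 u w)%:E.
Proof. by move=> t0; rewrite fineK//; exact: integral_age_fin_num. Qed.

Lemma age_integral_ge0 (t : R) w : (0 <= t)%R -> (0 <= age_integral t w)%R.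
Proof.
move=> t0; apply: fine_ge0; apply: integral_ge0 => u /=.
by rewrite in_itv/= => /andP[u0 _]; rewrite lee_fin; exact: age_ge0.
Qed.

Definition mean_age (t : R) : \bar R := \int[P]_w (t^-1 * age_integral t w)%:E.

Lemma average_ageE : average_age X S a0 = limf_esup mean_age (pinfty_nbhs R).
Proof. by rewrite /average_age unlock. Qed.

Lemma mean_age_ge0 (t : R) : (0 <= t)%R -> 0 <= mean_age t.
Proof.
move=> t0; apply: integral_ge0 => w _.
by rewrite lee_fin mulr_ge0 ?invr_ge0// age_integral_ge0.
Qed.

(** Expectation of [integral_age_ge] divided by [t]; [Wald_term] evaluates each of the [n]
    summands. *)
Lemma mean_age_ge_partial (t M : R) n : (0 < t)%R -> (0 <= M)%R ->
  ((2 * t)^-1 * \sum_(i < n) active_prob X t i)%:E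
    * \int[FX]_x (Num.min (x ^+ 2) M)%:E
  <= mean_age t + ((2 * t)^-1 * M)%:E.
Proof.
move=> t0 M0; set k := ((2 * t)^-1)%R.
have k0 : (0 <= k)%R by rewrite invr_ge0 mulr_ge0// ltW.
pose q (x : R) := Num.min (x ^+ 2)%R M.
have q0 x : (0 <= q x)%R by rewrite le_min sqr_ge0.
have mq : measurable_fun setT q by apply: measurable_minr.
pose Z w := (k * \sum_(i < n) active X t i w * q (X i w))%R.
have mZ : measurable_fun setT Z.
  apply: measurable_funM => //; apply: measurable_sum => i.
  apply: measurable_funM; first exact: measurable_active.
  exact: measurableT_comp.
have Z0 w : (0 <= Z w)%R.
  by rewrite mulr_ge0// sumr_ge0// => i _; rewrite mulr_ge0.
have -> : (k * \sum_(i < n) active_prob X t i)%:E * \int[FX]_x (q x)%:E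
    = \int[P]_w (Z w)%:E.
  under [RHS]eq_integral do rewrite EFinM -sumEFin.
  rewrite ge0_integralZl//; last 2 first.
  - apply: emeasurable_sum => i; apply/measurable_EFinP.
    apply: measurable_funM; first exact: measurable_active.
    exact: measurableT_comp.
  - by move=> w _; apply: sume_ge0 => i _; rewrite lee_fin mulr_ge0.
  rewrite ge0_integral_sum//; last 2 first.
  - move=> i; apply/measurable_EFinP.
    apply: measurable_funM; first exact: measurable_active.
    exact: measurableT_comp.
  - by move=> i w _; rewrite lee_fin mulr_ge0.
  rewrite (eq_bigr (fun i : 'I_n =>
    (active_prob X t i)%:E * \int[FX]_x (q x)%:E)); last first.
    by move=> i _; exact: (Wald_term queue t i mq (fun x _ => q0 x)).
  rewrite -ge0_sume_distrl; last by move=> i _; rewrite lee_fin active_prob_ge0.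
  by rewrite sumEFin muleA EFinM.
have ZL w : (Z w - k * M <= t^-1 * age_integral t w)%R.
  have := @integral_age_ge _ _ _ _ X S a0 w a0_ge0 (X_gt0 ^~ w) (S_ge0 ^~ w)
    t M n (ltW t0) M0.
rewrite -(age_integralK w (ltW t0)) -EFinD lee_fin => H.
  rewrite lerBlDr -(ler_pM2l t0).
  have -> : (t * Z w = 2^-1 * \sum_(i < n)
      (partial_sum (X ^~ w) i <= t)%R%:R * Num.min (X i w ^+ 2) M)%R.
    by rewrite /Z mulrA /k; congr (_ * _)%R; field; rewrite gt_eqF.
  apply: (le_trans H); rewrite le_eqVlt; apply/predU1P; left; rewrite /k; field.
  by rewrite gt_eqF.
(* The age integral is not known to be measurable, so additivity is applied to the measurable
   positive part [L] instead. It lies below the time average of the age, and [Z <= L + k * M]. *)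
pose L w := Num.max 0%R (Z w - k * M)%R.
have mL : measurable_fun setT L by apply: measurable_maxr => //; exact: measurable_funB.
apply: (@le_trans _ _ (\int[P]_w ((L w)%:E + (k * M)%:E))).
  apply: ge0_integral_mono => w _; first by rewrite lee_fin.
  rewrite -EFinD lee_fin -lerBlDr.
  by rewrite /L le_max lexx orbT.
rewrite ge0_integralD//; last 3 first.
- by move=> w _; rewrite lee_fin /L le_max lexx.
- exact/measurable_EFinP.
- by move=> w _; rewrite lee_fin mulr_ge0.
rewrite integral_cst//= probability_setT mule1 leeD2r//.
apply: ge0_integral_mono => w _; first by rewrite lee_fin /L le_max lexx.
rewrite lee_fin /L ge_max ZL andbT.
by rewrite mulr_ge0 ?invr_ge0 ?age_integral_ge0// ltW.
Qed.

(** The renewal function is eliminated: [mean_age_ge_partial] bounds it from above,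
    [expected_active_ge] from below. *)
Lemma mean_age_ge (t M e m1 eM z : R) : (0 < t)%R -> (0 <= M)%R -> (0 < e)%R ->
  \int[FX]_x x%:E = m1%:E -> (0 < eM)%R ->
  \int[FX]_x (Num.min (x ^+ 2) M)%:E = eM%:E -> mean_age t = z%:E ->
  (eM / 2 <= (z + M / (2 * t)) * (m1 + e))%R.
Proof.
move=> t0 M0 e0 Em1 eM0 EeM Ez.
have t2 : (0 < 2 * t)%R by rewrite mulr_gt0.
have m_le : expected_active X t <= ((z * (2 * t) + M) / eM)%:E.
  apply: nneseries_le_partial => [i|n]; first by rewrite lee_fin active_prob_ge0.
  have := @mean_age_ge_partial t M n t0 M0.
  rewrite EeM Ez -EFinM -EFinD sumEFin !lee_fin ler_pdivlMr// => H.
  rewrite -(ler_pM2l (_ : 0 < (2 * t)^-1)%R) ?invr_gt0//.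
  move: H; rewrite -mulrA => H; apply: (le_trans H).
  rewrite le_eqVlt; apply/predU1P; left.
  by rewrite mulrDr mulrCA mulVf ?mulr1// gt_eqF.
have := expected_active_ge queue _ (ltW t0) e0.
rewrite Em1 => /(_ isT) H.
have m1e : (0 <= m1 + e)%R.
  have : (0%:E <= m1%:E :> \bar R).
    rewrite -Em1 -(integral_law queue 0%N (g := id))//.
    by apply: integral_ge0 => w _; rewrite lee_fin ltW.
  by rewrite lee_fin => m10; rewrite addr_ge0// ltW.
have {H} : t%:E <= ((z * (2 * t) + M) / eM)%:E * (m1%:E + e%:E).
  by apply: (le_trans H); apply: lee_wpmul2r => //; rewrite -EFinD lee_fin.
rewrite -EFinD -EFinM lee_fin => H.
rewrite -(ler_pM2l (_ : 0 < 2 * t / eM)%R) ?divr_gt0//.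
have -> : (2 * t / eM * (eM / 2) = t)%R by field; rewrite gt_eqF.
apply: (le_trans H); rewrite le_eqVlt; apply/predU1P; left; field.
by rewrite !gt_eqF.
Qed.

(** The form with a real [y] and a strict inequality covers an infinite second moment as well. *)
Lemma average_age_ge (m1 y : R) : (0 < m1)%R -> \int[FX]_x x%:E = m1%:E ->
  (2 * y * m1)%:E < \int[FX]_x (x ^+ 2)%:E -> y%:E <= average_age X S a0.
Proof.
move=> m10 Em1 yE2; rewrite average_ageE.
apply: limf_esup_pinfty_ge => K.
have [y0|y0] := ltP y 0%R.
  exists (Num.max 0 K + 1)%R; first by rewrite ltr_pwDr// le_max lexx orbT.
  apply: (@le_trans _ _ 0); first by rewrite lee_fin ltW.
  by apply: mean_age_ge0; rewrite addr_ge0// le_max lexx.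
have [M M0 yM] : exists2 M : R, (0 < M)%R &
    (2 * y * m1)%:E < \int[FX]_x (Num.min (x ^+ 2) M)%:E.
  by apply: integral_truncation_gt => // x; exact: sqr_ge0.
have fM : \int[FX]_x (Num.min (x ^+ 2) M)%:E \is a fin_num.
  rewrite ge0_fin_numE; last first.
    by apply: integral_ge0 => x _; rewrite lee_fin le_min sqr_ge0 ltW.
  apply: (@le_lt_trans _ _ (\int[FX]_x (cst M%:E x))).
    apply: ge0_integral_mono => x _; rewrite lee_fin.
      by rewrite le_min sqr_ge0 ltW.
    by rewrite ge_min lexx orbT.
  by rewrite integral_cst//= probability_setT mule1 ltry.
move: yM; rewrite -(fineK fM) lte_fin; set eM := fine _ => yM.
have EeM := esym (fineK fM).
have eM0 : (0 < eM)%R by apply: le_lt_trans yM; rewrite !mulr_ge0// ltW.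
(* [g] is the slack left after truncation. Half of it pays for [y * e], by the choice of [e], and
   half for [M * (m1 + e) / (2 * t)], by the choice of [t]. *)
pose g := (eM / 2 - y * m1)%R; have g0 : (0 < g)%R by rewrite /g; lra.
pose e := (g / (2 * (y + 1)))%R.
have e0 : (0 < e)%R by rewrite divr_gt0// mulr_gt0// ltr_pwDr.
have ye : (y * e <= g / 2)%R.
  have -> : (y * e = (g / 2) * (y / (y + 1)))%R.
    by rewrite /e; field; rewrite gt_eqF// ltr_pwDr.
  apply: ler_piMr; first by rewrite divr_ge0// ltW.
  by rewrite ler_pdivrMr ?mul1r ?lerDl// ltr_pwDr.
pose t := (Num.max 1 (Num.max K (M * (m1 + e) / g)) + 1)%R.
have t1 : (1 < t)%R by rewrite /t ltr_pwDr// le_max lexx.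
have t0 : (0 < t)%R by lra.
have Kt : (K < t)%R by rewrite /t ltr_pwDr// !le_max lexx orbT.
have Mt : (M * (m1 + e) < t * g)%R.
  by rewrite -ltr_pdivrMr// /t ltr_pwDr// !le_max lexx !orbT.
(* A mean age below [y] would be finite, so [mean_age_ge] would apply to it and give a
   contradiction. *)
exists t => //; rewrite leNgt; apply/negP => ty.
have zf : mean_age t \is a fin_num.
  by rewrite ge0_fin_numE ?mean_age_ge0 ?ltW// (lt_trans ty)// ltry.
move: ty; rewrite -(fineK zf) lte_fin; set z := fine _ => zy.
have := @mean_age_ge t M e m1 eM z t0 (ltW M0) e0 Em1 eM0 EeM (esym (fineK zf)).
apply/negP; rewrite -ltNge.
have m1e : (0 < m1 + e)%R by rewrite addr_gt0.
apply: (@lt_trans _ _ ((y + M / (2 * t)) * (m1 + e))%R).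
  by rewrite ltr_pM2r// ltrD2r.
have -> : ((y + M / (2 * t)) * (m1 + e)
   = y * m1 + y * e + (M * (m1 + e) / t) / 2)%R.
  by field; rewrite gt_eqF.
have : (M * (m1 + e) / t < g)%R by rewrite ltr_pdivrMr// (mulrC g).
by move: ye; rewrite /g; lra.
Qed.

End Lower_bound.

(** * Upper bound on the average age *)

(** Summing the recursion bounds the total staleness by [a0 + p * m] plus [p] times itself, which
    can be solved because [p < 1]. *)
Lemma sum_staleness_cst_le {R : realType} (a0 p m : R) (x : nat -> R) n :
  0 <= a0 -> 0 <= p < 1 -> (forall i, 0 <= x i) ->
  (forall n, \sum_(i < n) x i <= m) ->
  \sum_(i < n) staleness a0 (fun=> p) x i <= (a0 + p * m) / (1 - p).
Proof.
move=> a0_ge0 /andP[p0 p1] x0 xm; set W := staleness _ _ _.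
have W0 i : 0 <= W i by exact: staleness_ge0.
have p1' : 0 < 1 - p by rewrite subr_gt0.
rewrite ler_pdivlMr//.
have E : \sum_(i < n.+1) W i
    = a0 + p * \sum_(i < n) W i + p * \sum_(i < n) x i.
  rewrite big_ord_recl -addrA -mulrDr -big_split/= mulr_sumr; congr (_ + _).
have : \sum_(i < n) W i <= \sum_(i < n.+1) W i by rewrite big_ord_recr/= lerDl.
have : p * \sum_(i < n) x i <= p * m by rewrite ler_wpM2l.
rewrite E mulrBr mulr1 (mulrC _ p); lra.
Qed.

Section Upper_bound.
Context {R : realType} d {T : measurableType d} (P : probability T R).
Variables (X S : nat -> {RV P >-> R}) (FX FS : probability R R) (a0 : R).
Hypotheses (queue : GGinf_queue X S FX FS) (a0_ge0 : 0 <= a0).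
Variables (m1 m2 : R).
Hypotheses (m1_gt0 : 0 < m1) (EX : (\int[FX]_x x%:E = m1%:E)%E)
  (EX2 : (\int[FX]_x (x ^+ 2)%:E = m2%:E)%E).
Variable delta : R.
Hypothesis delta_gt0 : 0 < delta.
Local Open Scope ereal_scope.

Let p := fine (FS [set s | (delta < s)%R]).
Hypothesis p_lt1 : (p < 1)%R.

Let X_gt0 i w : (0 < X i w)%R. Proof. by case: queue. Qed.
Let X_ge0 i w : (0 <= X i w)%R. Proof. exact: ltW. Qed.
Let S_ge0 i w : (0 <= S i w)%R. Proof. by case: queue. Qed.
Let p_ge0 : (0 <= p)%R. Proof. exact: fine_ge0. Qed.

Let late k w : R := (delta < S k w)%R%:R.

Let measurable_late : measurable [set s : R | (delta < s)%R].
Proof.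
by rewrite (_ : [set s | _] = `]delta, +oo[%classic)// set_itvoy.
Qed.

Let measurable_lateS k : measurable_fun setT (late k).
Proof. by apply: measurable_natr_bool; exact: measurable_fun_ltr. Qed.

(** The product is the indicator that packets [j] to [i - 1] are all late, and these are independent
    events of probability [p]. *)
Lemma expectation_late_run j i : (j <= i)%N ->
  \int[P]_w (\prod_(j <= k < i) late k w)%:E = (p ^+ (i - j))%:E.
Proof.
move=> ji; case: (queue) => _ _ _ iidS _.
rewrite -(mutually_independent_run iidS measurable_late ji).
set B := \bigcap_(k in _) _.
have mB : measurable B.
  by apply: bigcap_measurableType => k _; exact: measurable_RV_preimage.
rewrite -[B in RHS]setIT -(integral_indic P measurableT mB).
apply: eq_integral => w _; rewrite indicE; congr EFin.
have [Bw|nBw] := boolP (w \in B).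
  rewrite big_nat_cond big1// => k /andP[jki _].
  by rewrite /late; move/set_mem : Bw => /(_ k jki)/= ->.
have [k [jki Sk]] : exists k, (j <= k < i)%N /\ ~~ (delta < S k w)%R.
  apply: contrapT => h; move/negP : nBw; apply; apply/mem_set => k /= jki.
  by apply: contrapT => /negP Sk; apply: h; exists k.
rewrite (@big_cat_nat _ _ _ k)/=; [|by case/andP: jki|by case/andP: jki => _ /ltnW].
rewrite [X in (_ * X)%R]big_ltn; last by case/andP: jki.
by rewrite /late (negbTE Sk) mul0r mulr0.
Qed.

(** Independence of generation and service enters here: [f] is a function of the inter-generation
    times, the product one of the service times. *)
Lemma expectation_mul_late_run (f : T -> R) j i : (j <= i)%N ->
  measurable_fun (setT : set (g_sigma_algebraType
    (\bigcup_i preimage_set_system setT (X i) measurable))) f ->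
  measurable_fun setT f -> (forall w, 0 <= f w)%R ->
  \int[P]_w (f w * \prod_(j <= k < i) late k w)%:E
  = \int[P]_w (f w)%:E * (p ^+ (i - j))%:E.
Proof.
move=> ji mfX mf f0; rewrite -(expectation_late_run ji).
have mb : measurable_fun (setT : set (g_sigma_algebraType
    (\bigcup_i preimage_set_system setT (S i) measurable)))
    (fun w => \prod_(j <= k < i) late k w)%R.
  apply: measurable_prod => k _; apply: measurable_natr_bool.
  by apply: measurable_fun_ltr => //; exact: measurable_process.
apply: expectation_mul_indep => //.
- by apply: measurable_prod => k _; exact: measurable_lateS.
- by move=> w; apply: prodr_ge0.
- move=> A B mA mB; case: (queue) => _ _ _ _ indXS; apply: indXS.
  + by rewrite -[_ @^-1` _]setTI; exact: mfX.
  + by rewrite -[_ @^-1` _]setTI; exact: mb.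
Qed.

Let V i w := staleness a0 (late ^~ w) (X ^~ w) i.

Let measurable_activeX t i : measurable_fun (setT : set (g_sigma_algebraType
    (\bigcup_i preimage_set_system setT (X i) measurable))) (active X t i).
Proof.
apply: measurable_natr_bool; apply: measurable_fun_ler => //.
by apply: measurable_sum => k; exact: measurable_process.
Qed.

Lemma expectation_activeX t i :
  \int[P]_w (active X t i w * X i w)%:E = (active_prob X t i * m1)%:E.
Proof. by rewrite (Wald_term queue _ _ (g := id))// EX EFinM. Qed.

Lemma active_decr t j i w : (j <= i)%N -> (active X t i w <= active X t j w)%R.
Proof.
move=> ji; rewrite /active ler_nat.
have := partial_sum_le (X_ge0 ^~ w) ji.
case: (leP (partial_sum _ i) t) => //= it ji'.
by rewrite (le_trans ji' it).
Qed.

(** [active X t i] and [X j] belong to the past of [X i], so a factor [m1] splits off.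
    [active X t i] still involves [X j]; it is replaced by the larger [active X t j], which does
    not, and a second factor [m1] splits off. *)
Lemma expectation_activeXX t j i : (j < i)%N ->
  \int[P]_w (active X t i w * X j w * X i w)%:E
  <= (m1 * active_prob X t j * m1)%:E.
Proof.
move=> ji; case: (queue) => _ _ [indX _] _ _.
rewrite (@expectation_mul_past _ _ _ P X i
  (fun w => active X t i w * X j w)%R id indX)//.
- rewrite (integral_law queue _ (g := id))// EX EFinM lee_wpmul2r//.
    by rewrite lee_fin ltW.
  rewrite mulrC -expectation_activeX; apply: ge0_integral_mono => w _.
    by rewrite lee_fin mulr_ge0.
  by rewrite lee_fin ler_wpM2r// active_decr// ltnW.
- apply: measurable_funM; first exact: measurable_active_past.
  exact: measurable_past.
- by move=> w; rewrite mulr_ge0.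
Qed.

(** [stalenessE] expands [V i] into runs of late packets, whose expectations are powers of [p]. The
    resulting bounds fold back into a staleness with constant weight [p]. *)
Lemma expectation_stale t i :
  \int[P]_w (active X t i w * V i w * X i w)%:E
  <= (m1 * staleness a0 (fun=> p) (fun j => m1 * active_prob X t j)%R i)%:E.
Proof.
pose F0 w := (a0 * (active X t i w * X i w * \prod_(0 <= k < i) late k w))%R.
pose F (j : 'I_i) w :=
  (active X t i w * X j w * X i w * \prod_(j <= k < i) late k w)%R.
have mF0 : measurable_fun setT F0.
  apply: measurable_funM => //; apply: measurable_funM.
    by apply: measurable_funM => //; exact: measurable_active.
  by apply: measurable_prod => k _; exact: measurable_lateS.
have mF j : measurable_fun setT (F j).
  apply: measurable_funM.
    apply: measurable_funM => //; apply: measurable_funM => //.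
    exact: measurable_active.
  by apply: measurable_prod => k _; exact: measurable_lateS.
have F00 w : (0 <= F0 w)%R by rewrite !mulr_ge0// prodr_ge0.
have F_ge0 j w : (0 <= F j w)%R by rewrite !mulr_ge0// prodr_ge0.
have -> : \int[P]_w (active X t i w * V i w * X i w)%:E
    = \int[P]_w ((F0 w)%:E + \sum_(j < i) (F j w)%:E).
  apply: eq_integral => w _; rewrite sumEFin -EFinD; congr EFin.
  rewrite /V stalenessE mulrDr mulrDl; congr (_ + _)%R.
    by rewrite /F0; ring.
  by rewrite mulr_sumr mulr_suml; apply: eq_bigr => j _; rewrite /F; ring.
rewrite ge0_integralD//; last 4 first.
- by move=> w _; rewrite lee_fin.
- exact/measurable_EFinP.
- by move=> w _; apply: sume_ge0 => j _; rewrite lee_fin.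
- by apply: emeasurable_sum => j; exact/measurable_EFinP.
rewrite ge0_integral_sum//; last 2 first.
- by move=> j; exact/measurable_EFinP.
- by move=> j w _; rewrite lee_fin.
rewrite stalenessE mulrDr EFinD; apply: leeD.
  rewrite /F0; under eq_integral do rewrite EFinM.
  rewrite ge0_integralZl//; last 2 first.
  - apply/measurable_EFinP; apply: measurable_funM.
      by apply: measurable_funM => //; exact: measurable_active.
    by apply: measurable_prod => k _; exact: measurable_lateS.
  - by move=> w _; rewrite lee_fin !mulr_ge0// prodr_ge0.
  rewrite (expectation_mul_late_run (f := fun w => active X t i w * X i w)%R)//.
  (* The probability is bounded by 1 here: the power of [p] alone makes the initial-age term
     summable over [i]. *)
  - rewrite expectation_activeX -!EFinM lee_fin prodr_const_nat.
    rewrite (mulrCA m1) ler_wpM2l// ler_wpM2r ?exprn_ge0//.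
    by rewrite ler_piMl ?active_prob_le1// ltW.
  - by apply: measurable_funM => //; exact: measurable_process.
  - by apply: measurable_funM => //; exact: measurable_active.
  - by move=> w; rewrite mulr_ge0.
rewrite mulr_sumr -sumEFin; apply: lee_sum => j _.
rewrite (expectation_mul_late_run
  (f := fun w => active X t i w * X j w * X i w)%R).
- rewrite prodr_const_nat mulrA EFinM.
  apply: lee_wpmul2r; first by rewrite lee_fin exprn_ge0.
  apply: le_trans (expectation_activeXX _ _) _ => //.
  by rewrite lee_fin mulrC mulrA.
- exact: ltnW.
- apply: measurable_funM; last exact: measurable_process.
  by apply: measurable_funM => //; exact: measurable_process.
- apply: measurable_funM => //; apply: measurable_funM => //.
  exact: measurable_active.
- by move=> w; rewrite !mulr_ge0.
Qed.

(** The expected cost of a period, transients aside. Divided by [m1] it is [m2 / (2 * m1) + delta +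
    delta / m1 + m1 * p / (1 - p)]. *)
Let K := (delta * m1 + 2^-1 * m2 + delta + m1 ^+ 2 * p / (1 - p))%R.

Let m2_ge0 : (0 <= m2)%R.
Proof.
by rewrite -lee_fin -EX2; apply: integral_ge0 => x _; rewrite lee_fin sqr_ge0.
Qed.

(** The part of the cost of a period that depends on its length only. *)
Let g (x : R) : R := (delta * x + 2^-1 * x ^+ 2 + delta)%R.

Let measurable_g : measurable_fun setT g.
Proof.
by apply: measurable_funD => //; apply: measurable_funD; apply: measurable_funM.
Qed.

Let g_ge0 x : (0 <= x)%R -> (0 <= g x)%R.
Proof.
move=> x0; have d0 := ltW delta_gt0.
by rewrite /g !addr_ge0// mulr_ge0// ?invr_ge0// sqr_ge0.
Qed.

Let expectation_g :
  \int[FX]_x (g x)%:E = (delta * m1 + 2^-1 * m2 + delta)%:E.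
Proof.
have d0 := ltW delta_gt0.
have mX2 : measurable_fun setT (fun w => X 0%N w ^+ 2)%R by exact: measurable_funX.
rewrite -(integral_law queue 0%N)//.
have -> : \int[P]_w (g (X 0 w))%:E = \int[P]_w (delta%:E * (X 0 w)%:E
    + ((2^-1)%:E * (X 0 w ^+ 2)%:E + (cst delta%:E) w)).
  by apply: eq_integral => w _; rewrite -!EFinM -!EFinD addrA.
have i2 : (0 <= 2^-1 :> R)%R by rewrite invr_ge0.
rewrite ge0_integralD//; last 4 first.
- by move=> w _; rewrite lee_fin mulr_ge0.
- by apply/measurable_EFinP; exact: measurable_funM.
- by move=> w _; rewrite -EFinM -EFinD lee_fin addr_ge0// mulr_ge0// sqr_ge0.
- by apply: emeasurable_funD => //; apply/measurable_EFinP; exact: measurable_funM.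
rewrite ge0_integralD//; last 2 first.
- by move=> w _; rewrite -EFinM lee_fin mulr_ge0// sqr_ge0.
- by apply/measurable_EFinP; exact: measurable_funM.
rewrite integral_cst//= probability_setT mule1.
rewrite !ge0_integralZl//; last 4 first.
- exact/measurable_EFinP.
- by move=> w _; rewrite lee_fin sqr_ge0.
- exact/measurable_EFinP.
- by move=> w _; rewrite lee_fin.
rewrite (integral_law queue 0%N (g := id))// EX.
rewrite (integral_law queue 0%N (g := fun x => x ^+ 2)%R)//.
by rewrite EX2 -!EFinM -!EFinD addrA.
Qed.

Let V_ge0 i w : (0 <= V i w)%R.
Proof. by apply: staleness_ge0. Qed.

Let measurable_V i : measurable_fun setT (V i).
Proof.
rewrite /V; elim: i => [|i IH] /=; first exact: measurable_cst.
apply: measurable_funM; first exact: measurable_lateS.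
exact: measurable_funD.
Qed.

Lemma expectation_cycle_cost t i :
  \int[P]_w (active X t i w *
    ((V i w + delta) * X i w + X i w ^+ 2 / 2 + delta))%:E
  <= (active_prob X t i * (delta * m1 + 2^-1 * m2 + delta)
      + m1 * staleness a0 (fun=> p) (fun j => m1 * active_prob X t j)%R i)%:E.
Proof.
have -> : \int[P]_w (active X t i w *
      ((V i w + delta) * X i w + X i w ^+ 2 / 2 + delta))%:E
    = \int[P]_w ((active X t i w * g (X i w))%:E
        + (active X t i w * V i w * X i w)%:E).
  by apply: eq_integral => w _; rewrite -EFinD /g; congr EFin; ring.
rewrite ge0_integralD//; last 4 first.
- by move=> w _; rewrite lee_fin mulr_ge0// g_ge0.
- apply/measurable_EFinP; apply: measurable_funM; first exact: measurable_active.
  exact: measurableT_comp.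
- by move=> w _; rewrite lee_fin !mulr_ge0.
- apply/measurable_EFinP; apply: measurable_funM => //; apply: measurable_funM => //.
  exact: measurable_active.
rewrite EFinD; apply: leeD; last exact: expectation_stale.
by rewrite (Wald_term queue)// expectation_g EFinM.
Qed.

(** [(t + c) / e] bounds the renewal function, by [expected_active_le]. The other two summands come
    from the time before [delta] and from the initial age; divided by [t] they vanish in the
    limit. *)
Lemma mean_age_le (t c e : R) : (0 < t)%R -> (0 <= c)%R -> (0 < e)%R ->
  \int[FX]_x (Num.min x c)%:E = e%:E ->
  mean_age X S a0 t
  <= (t^-1 * ((a0 + delta) * delta + m1 * a0 / (1 - p) + (t + c) / e * K))%:E.
Proof.
move=> t0 c0 e0 Ee.
have p1 : (0 < 1 - p)%R by rewrite subr_gt0.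
have d0 := ltW delta_gt0.
pose m := ((t + c) / e)%R.
have sum_le n : (\sum_(i < n) active_prob X t i <= m)%R.
  rewrite /m ler_pdivlMr// -lee_fin EFinM -Ee.
  apply: le_trans (expected_active_le queue (ltW t0) c0).
  apply: lee_wpmul2r; first by rewrite Ee lee_fin ltW.
  rewrite -sumEFin -(big_mkord xpredT (fun i => (active_prob X t i)%:E)).
  by apply: nneseries_lim_ge => i _ _; rewrite lee_fin active_prob_ge0.
pose u i w : R := (active X t i w *
  ((V i w + delta) * X i w + X i w ^+ 2 / 2 + delta))%R.
have u0 i w : (0 <= u i w)%R.
  rewrite /u mulr_ge0// !addr_ge0//; first by rewrite mulr_ge0// addr_ge0.
  by rewrite mulr_ge0// ?invr_ge0// sqr_ge0.
have mu i : measurable_fun setT (u i).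
  apply: measurable_funM; first exact: measurable_active.
  apply: measurable_funD => //; apply: measurable_funD; apply: measurable_funM => //.
    exact: measurable_funD.
  exact: measurable_funX.
have m_series : measurable_fun setT (fun w => \sum_(0 <= i <oo) (u i w)%:E).
  apply: ge0_emeasurable_sum => [i w _ _|i _]; first by rewrite lee_fin.
  exact/measurable_EFinP.
have series0 w : 0 <= \sum_(0 <= i <oo) (u i w)%:E.
  by apply: nneseries_ge0 => i _ _; rewrite lee_fin.
have b0 : (0 <= (a0 + delta) * delta)%R by rewrite mulr_ge0// addr_ge0.
have ti0 : (0 <= t^-1)%R by rewrite invr_ge0 ltW.
apply: (@le_trans _ _ (\int[P]_w (t^-1%:E * (((a0 + delta) * delta)%:E
    + \sum_(0 <= i <oo) (u i w)%:E)))).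
  apply: ge0_integral_mono => w _.
    by rewrite lee_fin mulr_ge0// (age_integral_ge0 queue a0_ge0)// ltW.
  rewrite EFinM lee_wpmul2l// (age_integralK queue a0_ge0)//; last exact: ltW.
  by apply: integral_age_le => //; exact: ltW.
rewrite ge0_integralZl//; last 2 first.
- exact: emeasurable_funD.
- by move=> w _; rewrite adde_ge0.
rewrite [leRHS]EFinM lee_wpmul2l// ge0_integralD//.
rewrite integral_cst//= probability_setT mule1.
rewrite -[X in _ <= X%:E]addrA [leRHS]EFinD leeD2l//.
rewrite integral_nneseries//; last 2 first.
- by move=> i; exact/measurable_EFinP.
- by move=> i w _; rewrite lee_fin.
apply: nneseries_le_partial => [i|n].
  by apply: integral_ge0 => w _; rewrite lee_fin.
apply: le_trans (lee_sum _ _) _; first by move=> i _; exact: expectation_cycle_cost.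
rewrite sumEFin lee_fin big_split/= -mulr_suml -mulr_sumr.
(* The staleness is summed with [m1 * active_prob X t j] as lengths, of total at most [m1 * m]. *)
have x0 j : (0 <= m1 * active_prob X t j)%R.
  by rewrite mulr_ge0 ?active_prob_ge0// ltW.
have xm k : (\sum_(j < k) m1 * active_prob X t j <= m1 * m)%R.
  by rewrite -mulr_sumr ler_wpM2l// ltW.
have p01 : (0 <= p < 1)%R by rewrite p_ge0.
have H := sum_staleness_cst_le n a0_ge0 p01 x0 xm.
apply: (@le_trans _ _ (m * (delta * m1 + 2^-1 * m2 + delta)
    + m1 * ((a0 + p * (m1 * m)) / (1 - p)))%R).
  apply: lerD; last by rewrite ler_wpM2l// ltW.
  apply: ler_wpM2r; last exact: sum_le.
  by rewrite !addr_ge0 ?mulr_ge0 ?invr_ge0// ltW.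
rewrite -/m /K le_eqVlt; apply/predU1P; left; field.
by rewrite gt_eqF.
Qed.

Lemma average_age_le (y : R) : (K < y * m1)%R -> average_age X S a0 <= y%:E.
Proof.
move=> Ky; have p1 : (0 < 1 - p)%R by rewrite subr_gt0.
have d0 := ltW delta_gt0.
have K0 : (0 < K)%R.
  rewrite /K ltr_wpDr//; first by rewrite divr_ge0// ?mulr_ge0// ?sqr_ge0// ltW.
  by rewrite ltr_wpDl// addr_ge0 ?mulr_ge0 ?invr_ge0// ltW.
have y0 : (0 < y)%R by rewrite -(pmulr_lgt0 _ m1_gt0); exact: lt_trans Ky.
(* Since [K / y < m1], some truncation keeps the mean [e] above [K / y], so that [K / e < y]. *)
have [c c0 yc] : exists2 c : R, (0 < c)%R &
    (K / y)%:E < \int[P]_w (Num.min (X 0 w) c)%:E.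
  apply: integral_truncation_gt => //.
  rewrite (integral_law queue 0%N (g := id))// EX lte_fin.
  by rewrite ltr_pdivrMr// mulrC.
have mmin : measurable_fun setT (fun x : R => Num.min x c) by exact: measurable_minr.
rewrite (integral_law queue 0%N mmin) in yc.
have fe := truncated_mean_fin_num queue (ltW c0).
move: yc; rewrite -(fineK fe) lte_fin; set e := fine _ => ye.
have Ee := esym (fineK fe).
have e0 : (0 < e)%R by apply: lt_trans ye; rewrite divr_gt0.
rewrite average_ageE.
pose C := ((a0 + delta) * delta + m1 * a0 / (1 - p) + c / e * K)%R.
have C0 : (0 <= C)%R.
  have [m1' p1' c' e' K'] := And5 (ltW m1_gt0) (ltW p1) (ltW c0) (ltW e0) (ltW K0).
  have b0 : (0 <= a0 + delta)%R by rewrite addr_ge0.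
  by rewrite /C; repeat (assumption || apply: addr_ge0 || apply: mulr_ge0
    || rewrite invr_ge0).
have gap : (0 < y - K / e)%R.
  by rewrite subr_gt0 ltr_pdivrMr// mulrC -ltr_pdivrMr.
(* The bound on the mean age is [K / e + C / t], which is at most [y] beyond this threshold. *)
apply: (@limf_esup_pinfty_le _ _ _ (C / (y - K / e))%R) => t Ct.
have t0 : (0 < t)%R by apply: le_lt_trans Ct; rewrite divr_ge0// ltW.
apply: (le_trans (mean_age_le t0 (ltW c0) e0 Ee)).
rewrite lee_fin.
have -> : (t^-1 * ((a0 + delta) * delta + m1 * a0 / (1 - p) + (t + c) / e * K)
    = K / e + C / t)%R.
  by rewrite /C; field; rewrite !gt_eqF.
rewrite -lerBrDl ler_pdivrMr// mulrC -ler_pdivrMr//; exact: ltW.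
Qed.

End Upper_bound.

(** * The limit in the parameter *)

Theorem lemma4 (R : realType)
  (lambda mu : R) (lambda_gt0 : 0 < lambda) (lambda_lt_mu : lambda < mu)
  (* the parameter eta ranges over D and tends to etastar, which need not be
     in D *)
  (H : topologicalType) (D : set H) (etastar : H)
  (FX : probability R R) (FS : H -> probability R R)
  (d : H -> measure_display) (Omega : forall eta : H, measurableType (d eta))
  (P : forall eta : H, probability (Omega eta) R)
  (X S : forall eta : H, nat -> {RV (P eta) >-> R})
  (a0 : R) (a0_ge0 : 0 <= a0)
  (queue : forall eta : H, D eta ->
    GGinf_queue (X eta) (S eta) FX (FS eta))
  (EX : ('E_FX[fun x : R => x] = (lambda^-1)%:E)%E)
  (S_continuous : forall eta : H, D eta ->
    continuous (fun s : R => FS eta `]-oo, s]%classic))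
  (ES : forall eta : H, D eta ->
    ('E_(FS eta)[fun s : R => s] = (mu^-1)%:E)%E)
  (tail_S : forall x : R, 0 < x ->
    ('E_(FS eta)[\1_[set s : R | (x < s)%R]])%E
      @[eta --> within D etastar^'] --> 0%E)
  (truncated_mean_S : forall x : R, 0 < x ->
    ('E_(FS eta)[fun s : R => (s * \1_[set s : R | (s <= x)%R] s)%R])%E
      @[eta --> within D etastar^'] --> 0%E) :
  average_age (X eta) (S eta) a0 @[eta --> within D etastar^'] -->
    ((2^-1)%:E * ('E_FX[fun x : R => (x ^+ 2)%R] / 'E_FX[fun x : R => x]))%E.
Proof.
pose m1 := lambda^-1.
have m1_gt0 : 0 < m1 by rewrite invr_gt0.
have EX1 : (\int[FX]_x x%:E = m1%:E)%E by move: EX; rewrite unlock.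
have -> : ('E_FX[fun x : R => (x ^+ 2)%R] = \int[FX]_x (x ^+ 2)%:E)%E.
  by rewrite unlock.
have E2_ge0 : (0 <= \int[FX]_x (x ^+ 2)%:E)%E.
  by apply: integral_ge0 => x _; rewrite lee_fin sqr_ge0.
rewrite EX -/m1 inver gt_eqF//.
case E2 : (\int[FX]_x (x ^+ 2)%:E)%E E2_ge0 => [m2| |] // m2_ge0; last first.
  (* With an infinite second moment the average age is infinite for every [eta] in [D], so the limit
     is that of a constant. *)
  rewrite gt0_mulye ?lte_fin ?invr_gt0// gt0_muley ?lte_fin ?invr_gt0//.
  apply: cvg_near_cst; apply: filterS (withinT D _) => eta Deta.
  apply/eqyP => y _.
  by apply: (average_age_ge (queue _ Deta) a0_ge0 m1_gt0 EX1); rewrite E2 ltry.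
rewrite -!EFinM; set l := 2^-1 * (m2 / m1).
have age_ge eta : D eta -> (l%:E <= average_age (X eta) (S eta) a0)%E.
  (* [average_age_ge] asks for a strict inequality, hence the margin [e]. *)
  move=> Deta; apply/lee_addgt0Pr => e e0; rewrite -leeBlDr// -EFinB.
  apply: (average_age_ge (queue _ Deta) a0_ge0 m1_gt0 EX1).
  rewrite E2 lte_fin mulrBr mulrBl.
  have -> : 2 * l * m1 = m2 by rewrite /l; field; rewrite gt_eqF.
  by rewrite ltrBlDr ltrDl !mulr_gt0.
have age_le (e : R) : 0 < e ->
    \forall eta \near within D etastar^',
      D eta /\ (average_age (X eta) (S eta) a0 <= (l + e)%:E)%E.
  (* The excess [e] is halved: [delta] solves [delta * m1 + delta = e / 2 * m1], and [p0] solves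
     [m1 ^+ 2 * p / (1 - p) = e / 2 * m1] for [p]. *)
  move=> e0; pose delta : R := e * m1 / (2 * (m1 + 1)).
  have m11 : 0 < m1 + 1 by rewrite addr_gt0.
  have delta0 : 0 < delta by rewrite divr_gt0 ?mulr_gt0.
  pose p0 : R := (e / 2) / (m1 + e / 2).
  have e2 : 0 < e / 2 by rewrite divr_gt0.
  have m1e : 0 < m1 + e / 2 by rewrite addr_gt0.
  have p00 : 0 < p0 by rewrite divr_gt0.
  have small : \forall eta \near within D etastar^',
      fine ('E_(FS eta)[\1_[set s : R | (delta < s)%R]])%E < p0.
    exact: (cvgr_lt 0 (fine_cvg (tail_S _ delta0))).
  near=> eta.
  have Deta : D eta by near: eta; exact: withinT.
  split => //; set p := fine (FS eta [set s | delta < s]).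
  have pp0 : p < p0.
    have mA : measurable [set s : R | delta < s].
      by rewrite (_ : [set s | _] = `]delta, +oo[%classic)// set_itvoy.
    have -> : p = fine ('E_(FS eta)[\1_[set s : R | (delta < s)%R]])%E.
      by rewrite unlock integral_indic// setIT.
    by near: eta.
  have p1 : p < 1.
    by apply: (lt_trans pp0); rewrite ltr_pdivrMr// mul1r ltrDr.
  apply: (average_age_le (queue _ Deta) a0_ge0 m1_gt0 EX1 E2 delta0) => //.
  rewrite -/p.
  have pe : m1 ^+ 2 * p / (1 - p) < e / 2 * m1.
    rewrite ltr_pdivrMr ?subr_gt0// expr2 -mulrA -[ltRHS]mulrA.
    rewrite [ltRHS]mulrCA ltr_pM2l//.
    by move: pp0; rewrite ltr_pdivlMr//; lra.
  have de : delta * m1 + delta = e / 2 * m1.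
    by rewrite /delta; field; rewrite gt_eqF.
  have lm : (l + e) * m1 = 2^-1 * m2 + e * m1.
    by rewrite /l; field; rewrite gt_eqF.
  by rewrite lm; lra.
(* The two bounds first make the average age eventually finite, with excess 1, and then squeeze its
   real value. *)
apply/fine_cvgP; split.
  near=> eta.
  have [Deta le1] : D eta /\ (average_age (X eta) (S eta) a0 <= (l + 1)%:E)%E.
    by near: eta; exact: age_le.
  rewrite fin_numE -ltNye -ltey (lt_le_trans _ (age_ge _ Deta)) ?ltNyr//=.
  by rewrite (le_lt_trans le1)// ltry.
apply/cvgrPdist_le => e e0; near=> eta.
have [Deta] : D eta /\ (average_age (X eta) (S eta) a0 <= (l + e)%:E)%E.
  by near: eta; exact: age_le.
have := age_ge _ Deta.
rewrite /=; case: (average_age _ _ _) => [r| |] //=; rewrite !lee_fin => lr rl.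
by rewrite ler_distlC; apply/andP; split; lra.
Unshelve. all: by end_near.
Qed.
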